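(* Let $k,p$ be positive real numbers, $n,j\in\mathbb{N}$ with $n,j\ge1$, and $x\in\mathbb{C}\setminus k\mathbb{Z}^{-}$ with $\mathrm{Re}(x)>0$. Then $$np\;{}_{p}(x)_{n-1,k}={}_{p}(x)_{n,k}-{}_{p}(x-k)_{n,k}$$ and $${}_{p}(x)_{n+j,k}={}_{p}(x)_{j,k}\cdot{}_{p}(x+jk)_{n,k}.$$
   Context: $\mathbb{Z}^-$ is the set of negative integers. The p-k Pochhammer symbol is, for $z\in\mathbb{C}$, ${}_{p}(z)_{n,k}=\left(\frac{zp}{k}\right)\left(\frac{zp}{k}+p\right)\cdots\left(\frac{zp}{k}+(n-1)p\right)$ for $n\ge1$, and ${}_{p}(z)_{0,k}=1$ (empty product). *)

(* Defs.v *)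
From mathcomp Require Import all_boot all_order all_algebra.
From mathcomp Require Import complex.
From mathcomp Require Import reals.

Set Implicit Arguments.
Unset Strict Implicit.
Unset Printing Implicit Defensive.

Import Order.TTheory GRing.Theory Num.Theory.

Local Open Scope ring_scope.
Local Open Scope complex_scope.

Definition pk_pochhammer (R : realType) (p k : R) (z : R[i]) (n : nat) : R[i] :=
  \prod_(i < n) (z * p%:C / k%:C + i%:R * p%:C).

(* Main.v *)
(** With [a = x p / k], the symbol is the rising product of the [a + i p], and
    replacing [x] by [x + j k] shifts [a] by [j p]: splitting the product after
    [j] factors gives the second identity.  Its case [j = 1] at [x - k] shows
    that both terms of the difference contain the symbol of order [n - 1] at
    [x], with remaining factors [a + (n - 1) p] and [a - p]. *)
Require Import Defs.
From mathcomp Require Import all_boot all_order all_algebra.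
From mathcomp Require Import complex.
From mathcomp Require Import reals.
From mathcomp Require Import ring.

Set Implicit Arguments.
Unset Strict Implicit.
Unset Printing Implicit Defensive.

Import Order.TTheory GRing.Theory Num.Theory.

Local Open Scope ring_scope.
Local Open Scope complex_scope.

Lemma pk_pochhammerD (R : realType) (p k : R) (x : R[i]) (n j : nat) :
  k != 0 ->
  pk_pochhammer p k x (n + j)
    = pk_pochhammer p k x j * pk_pochhammer p k (x + j%:R * k%:C) n.
Proof.
move=> k0; have kC0 : k%:C != 0 :> R[i] by rewrite fmorph_eq0.
(* [addnC] puts the [j] factors first; the other [n] then carry indices [j + i], where [j * p]
   equals [j * k * p / k]. *)
rewrite /pk_pochhammer addnC big_split_ord /=; congr (_ * _).
apply: eq_bigr => i _; rewrite natrD; field.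
exact: kC0.
Qed.

Lemma pk_pochhammer_diff (R : realType) (p k : R) (x : R[i]) (n : nat) :
  k != 0 ->
  pk_pochhammer p k x n.+1 - pk_pochhammer p k (x - k%:C) n.+1
    = n.+1%:R * p%:C * pk_pochhammer p k x n.
Proof.
move=> k0; have kC0 : k%:C != 0 :> R[i] by rewrite fmorph_eq0.
rewrite -[X in _ - pk_pochhammer _ _ _ X]addn1 pk_pochhammerD // mul1r subrK.
rewrite /pk_pochhammer big_ord_recr big_ord1 /=.
(* With the common product [P] opaque, what remains is [(a + n p) - (a - p) = (n + 1) p] times [P],
   where [a = x p / k]. *)
set P := \prod_(_ < _) _.
rewrite -natr1; field.
exact: kC0.
Qed.

Theorem theorem2p12 (R : realType) (k p : R) (n j : nat) (x : R[i])
  (k_gt0 : 0 < k) (p_gt0 : 0 < p) (n_ge1 : (1 <= n)%N) (j_ge1 : (1 <= j)%N)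
  (x_notin_kZneg : ~ (exists2 m : int, m < 0 & x = (k * m%:~R)%:C))
  (Re_x_gt0 : 0 < complex.Re x) :
  n%:R * p%:C * pk_pochhammer p k x (n - 1)
    = pk_pochhammer p k x n - pk_pochhammer p k (x - k%:C) n
  /\
  pk_pochhammer p k x (n + j)
    = pk_pochhammer p k x j * pk_pochhammer p k (x + j%:R * k%:C) n.
Proof.
have k0 : k != 0 by rewrite gt_eqF.
split; last exact: pk_pochhammerD.
(* As [n] is positive, the truncated [n - 1] is the true predecessor [m]. *)
by case: n n_ge1 => // m _; rewrite subn1 pk_pochhammer_diff.
Qed.
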